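(* Consider the planted matching model with parameters $(n,d,\mathcal{P},\mathcal{Q})$ described in the context, and let $\hat M_{\mathsf{ML}}$ be the maximum likelihood estimator of $M^*$. Assume that \[ \sqrt{d}\;B(\mathcal{P},\mathcal{Q}) \le 1+\epsilon \] for some $\epsilon\ge 0$. Then there exists a universal constant $C>0$ such that for all sufficiently large $n$, \[ \mathbb{E}\left[\ell(M^*,\hat M_{\mathsf{ML}})\right]\le C\max\left\{\log(1+\epsilon),\sqrt{\frac{\log n}{n}}\right\}. \]
   Context: Planted matching model: Let $K_{n,n}$ be the complete bipartite graph with left vertices $[n]=\{1,\dots,n\}$ and right vertices $[n]'=\{1',\dots,n'\}$; a perfect matching is viewed as a set of $n$ edges. Sample $M^*$ uniformly at random from the set $\mathcal{M}$ of perfect matchings of $K_{n,n}$. The observed graph $G$ contains every edge of $M^*$, and each of the $n(n-1)$ pairs $(i,j')\notin M^*$ independently with probability $d/n$. Edges of $G$ carry independent weights $W_e$: distributed according to $\mathcal{P}$ if $e\in M^*$ and according to $\mathcal{Q}$ if $e\notin M^*$. The observation is the weighted graph $G$. For an estimator $\hat M$, the reconstruction error is $\ell(\hat M,M^* )=\frac1n|M^*\triangle \hat M|$. The maximum likelihood estimator $\hat M_{\mathsf{ML}}$ is any perfect matching maximizing the likelihood of the observation given $M^*=M$ over $M\in\mathcal{M}$ (when $\mathcal{P}\ll\mathcal{Q}$ this is a maximizer of $\sum_{e\in M}\log\frac{d\mathcal{P}}{d\mathcal{Q}}(W_e)$ over perfect matchings $M$ contained in $G$). The Bhattacharyya coefficient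 is $B(\mathcal{P},\mathcal{Q})=\int\sqrt{fg}\,d\mu$, where $f,g$ are densities of $\mathcal{P},\mathcal{Q}$ with respect to a common dominating measure $\mu$. *)

(* Defs.v *)
From HB Require Import structures.
From mathcomp Require Import all_boot all_order all_algebra all_fingroup.
From mathcomp Require Import all_classical all_reals all_analysis.
Set Implicit Arguments. Unset Strict Implicit. Unset Printing Implicit Defensive.
Import Order.TTheory GRing.Theory Num.Theory.
Local Open Scope ring_scope.
Local Open Scope classical_set_scope.

Section PlantedMatching.
Context {R : realType}.

(* A perfect matching of K_{n,n}: the edge set {(i, s i)} of a permutation s
   (left vertex i matched to right vertex (s i)'). *)
Definition matching_of (n : nat) (s : {perm 'I_n}) : {set 'I_n * 'I_n} :=
  [set (i, s i) | i : 'I_n].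

Definition loss (n : nat) (s t : {perm 'I_n}) : R :=
  #|(matching_of s :\: matching_of t) :|: (matching_of t :\: matching_of s)|%:R
  / n%:R.

(* P(G = G | M* = M_s): M_s included in G, and each of the n(n-1) other pairs
   present independently with probability d/n *)
Definition graph_prob (n : nat) (d : R) (s : {perm 'I_n})
    (G : {set 'I_n * 'I_n}) : R :=
  (matching_of s \subset G)%:R
  * (d / n%:R) ^+ #|G :\: matching_of s|
  * (1 - d / n%:R) ^+ (n * (n - 1) - #|G :\: matching_of s|).

Context {dX : measure_display} {X : measurableType dX}.

(* likelihood (density w.r.t. counting x mu^G) of observing the weighted graph
   (G, w restricted to G) when M* = M_s; f, g densities of P, Q *)
Definition likelihood (n : nat) (d : R) (f g : X -> R)
    (G : {set 'I_n * 'I_n}) (w : 'I_n * 'I_n -> X) (s : {perm 'I_n}) : R :=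
  graph_prob d s G
  * (\prod_(e in matching_of s) f (w e))
  * (\prod_(e in G :\: matching_of s) g (w e)).

Definition is_ML (n : nat) (d : R) (f g : X -> R)
    (G : {set 'I_n * 'I_n}) (w : 'I_n * 'I_n -> X) (t : {perm 'I_n}) : Prop :=
  forall s : {perm 'I_n}, likelihood d f g G w s <= likelihood d f g G w t.

Definition ML_estimator (n : nat) (d : R) (f g : X -> R)
    (est : {set 'I_n * 'I_n} -> ('I_n * 'I_n -> X) -> {perm 'I_n}) : Prop :=
  (forall (G : {set 'I_n * 'I_n}) (w w' : 'I_n * 'I_n -> X),
     (forall e, e \in G -> w e = w' e) -> est G w = est G w') /\
  (forall (G : {set 'I_n * 'I_n}) (w : 'I_n * 'I_n -> X), is_ML d f g G w (est G w)).

Definition is_density (mu : {measure set X -> \bar R}) (P : probability X R)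
    (f : X -> R) : Prop :=
  (forall x, 0 <= f x) /\ measurable_fun setT f /\
  (forall A, measurable A -> P A = (\int[mu]_(x in A) (f x)%:E)%E).

Definition bhattacharyya (mu : {measure set X -> \bar R}) (f g : X -> R)
    : \bar R :=
  (\int[mu]_x (Num.sqrt (f x * g x))%:E)%E.

(* (Ms, Gr, W) on the probability space (Om, Pr) follow the planted matching
   model: M* uniform, G | M* as in graph_prob, and independent weights W_e
   (law P on M*, Q off M*; only the weights of edges of G are observed). *)
Definition planted_model (n : nat) (d : R) (P Q : probability X R)
    {dO : measure_display} {Om : measurableType dO} (Pr : probability Om R)
    (Ms : Om -> {perm 'I_n}) (Gr : Om -> {set 'I_n * 'I_n})
    (W : Om -> 'I_n * 'I_n -> X) : Prop :=
  (forall s, measurable [set om | Ms om = s]) /\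
  (forall G, measurable [set om | Gr om = G]) /\
  (forall e, measurable_fun setT (fun om => W om e)) /\
  (forall (s : {perm 'I_n}) (G : {set 'I_n * 'I_n}) (A : 'I_n * 'I_n -> set X),
     (forall e, measurable (A e)) ->
     Pr [set om | Ms om = s /\ Gr om = G /\ forall e, A e (W om e)] =
     ((n`!%:R)^-1 * graph_prob d s G *
      \prod_(e : 'I_n * 'I_n)
         fine (if e \in matching_of s then P (A e) else Q (A e)))%:E).

End PlantedMatching.

(* Main.v *)
Require Import Defs.
From HB Require Import structures.
From mathcomp Require Import all_boot all_order all_algebra all_fingroup.
From mathcomp Require Import all_classical all_reals all_analysis.
From mathcomp Require Import measurable_realfun.
From mathcomp Require Import ring lra zify.
Import Order.TTheory GRing.Theory Num.Theory.
Local Open Scope ring_scope.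
Local Open Scope classical_set_scope.

(* If the maximum likelihood matching is M_t while the truth is M_s, then the
   likelihood ratio of t to s is at least 1, so is its square root, and by
   Markov's inequality this has probability at most (d B^2 / n)^k, where k is
   the number of vertices on which s and t disagree.  There are at most
   n (n-1) ... (n-k+1) <= n^k exp(- k (k-1) / 2n) such t, so the terms of the
   union bound are at most exp(2 k ln (1 + eps) - k (k-1) / 2n), which is below
   n^-2 once k >= 8 n max (ln (1 + eps), sqrt (ln n / n)). *)

(** * Integrals of functions of random variables *)

Section WeightedIntegral.
Import HBNNSimple.

(** The hypothesis says that the image under [U] of the measure with density [G] is [c] times [nu].
    It extends from indicators to simple functions by linearity, then to [h] by monotone
    convergence. With [U] the identity this integrates against a density; with [U] one weight it
    frees one coordinate of a product. *)
Lemma ge0_integral_weighted (R : realType) (d1 d2 : measure_display)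
    (T : measurableType d1) (X : measurableType d2)
    (m : {measure set T -> \bar R}) (nu : {measure set X -> \bar R})
    (G : T -> R) (U : T -> X) (c : R) :
  measurable_fun setT G -> (forall x, 0 <= G x) -> measurable_fun setT U ->
  0 <= c ->
  (forall A, measurable A ->
     (\int[m]_x (G x * \1_A (U x))%:E = c%:E * nu A)%E) ->
  forall h : X -> R, measurable_fun setT h -> (forall y, 0 <= h y) ->
    (\int[m]_x (G x * h (U x))%:E = c%:E * \int[nu]_y (h y)%:E)%E.
Proof.
move=> mG G0 mU c0 HA h mh h0.
have mh' : measurable_fun setT (fun y => (h y)%:E) by exact/measurable_EFinP.
pose g := nnsfun_approx measurableT mh'.
have h0' x : [set: X] x -> (0 <= (h x)%:E)%E by rewrite lee_fin.
have gh x : EFin (g n x) @[n --> \oo] --> (h x)%:E.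
  exact: (cvg_nnsfun_approx measurableT mh' h0').
have gnd x : nondecreasing_seq (g ^~ x).
  by move=> a b ab; exact/lefP/nd_nnsfun_approx.
have mgU n : measurable_fun setT (fun x => g n (U x)).
  by apply: measurableT_comp.
have key n : (\int[m]_x (G x * g n (U x))%:E = c%:E * \int[nu]_y (g n y)%:E)%E.
  have fgn : finite_set (range (g n)) by exact: fimfunP.
  (* A simple function is the finite sum of its values times indicators of their fibres, and the
     hypothesis applies to each fibre. *)
  have -> : (\int[m]_x (G x * g n (U x))%:E =
      \int[m]_x \sum_(y \in range (g n))
        (y * (G x * \1_(g n @^-1` [set y]) (U x)))%:E)%E.
    apply: eq_integral => x _; rewrite fsumEFin//; congr EFin.
    rewrite [in LHS](fimfunE (g n)) mulr_fsumr.
    by apply: eq_fsbigr => y _; rewrite mulrCA.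
  have mi y : measurable_fun setT (fun x => \1_(g n @^-1` [set y]) (U x) : R).
    apply: measurableT_comp => //.
  rewrite ge0_integral_fsum//; last 2 first.
  - move=> y; apply/measurable_EFinP; apply: measurable_funM => //.
    exact: measurable_funM.
  - move=> y x _; rewrite lee_fin mulrCA mulr_ge0//.
    by have := nnfun_muleindic_ge0 (g n) y (U x); rewrite -EFinM lee_fin.
  rewrite integralT_nnsfun sintegralE ge0_mule_fsumr; last first.
    by move=> y; exact: nnsfun_mulemu_ge0.
  apply: eq_fsbigr => y; rewrite inE => -[z _ <-].
  under eq_integral do rewrite EFinM.
  rewrite ge0_integralZl//; last 3 first.
  - by apply/measurable_EFinP; exact: measurable_funM.
  - by move=> x _; rewrite lee_fin mulr_ge0.
  - by rewrite lee_fin.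
  by rewrite HA// muleCA.
have lim1 : (\int[m]_x (G x * g n (U x))%:E @[n --> \oo] -->
    \int[m]_x (G x * h (U x))%:E)%E.
  have -> : (\int[m]_x (G x * h (U x))%:E =
      \int[m]_x limn (fun n => (G x * g n (U x))%:E))%E.
    apply: eq_integral => x _; apply/esym/cvg_lim => //.
    under eq_fun do rewrite EFinM.
    by rewrite EFinM; apply: cvgeZl.
  apply: cvg_monotone_convergence => //.
  - by move=> n; apply/measurable_EFinP; exact: measurable_funM.
  - by move=> n x _; rewrite lee_fin mulr_ge0.
  - by move=> x _ a b ab; rewrite lee_fin ler_wpM2l// gnd.
have lim2 : (\int[nu]_y (g n y)%:E @[n --> \oo] --> \int[nu]_y (h y)%:E)%E.
  have -> : (\int[nu]_y (h y)%:E = \int[nu]_y limn (fun n => (g n y)%:E))%E.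
    by apply: eq_integral => x _; apply/esym/cvg_lim.
  apply: cvg_monotone_convergence => //.
  - by move=> n; apply/measurable_EFinP.
  - by move=> n x _; rewrite lee_fin.
  - by move=> x _ a b ab; rewrite lee_fin gnd.
have lim3 : (\int[m]_x (G x * g n (U x))%:E @[n --> \oo] -->
    c%:E * \int[nu]_y (h y)%:E)%E.
  by rewrite (funext key); apply: cvgeZl.
exact: (cvg_unique _ lim1 lim3).
Qed.

End WeightedIntegral.

(* The product formula passes from rectangles to arbitrary factors one coordinate
   at a time, which avoids product measures. *)
Lemma integral_prod_rectangles (R : realType) (dO dX : measure_display)
    (Om : measurableType dO) (X : measurableType dX) (I : finType)
    (m : {measure set Om -> \bar R}) (W : Om -> I -> X)
    (nu : I -> probability X R) (E : set Om) (c : R) :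
  measurable E -> (forall e, measurable_fun setT (fun om => W om e)) ->
  0 <= c ->
  (forall A : I -> set X, (forall e, measurable (A e)) ->
     m [set om | E om /\ forall e, A e (W om e)] =
     (c * \prod_e fine (nu e (A e)))%:E) ->
  forall (h : I -> X -> R) (b : I -> R),
    (forall e, measurable_fun setT (h e)) -> (forall e x, 0 <= h e x) ->
    (forall e, (\int[nu e]_x (h e x)%:E = (b e)%:E)%E) ->
    (\int[m]_om (\1_E om * \prod_e h e (W om e))%:E = (c * \prod_e b e)%:E)%E.
Proof.
move=> mE mW c0 HE h b mh h0 hb.
have mprod (k : I -> X -> R) (P : pred I) :
    (forall e, measurable_fun setT (k e)) ->
    measurable_fun setT (fun om => \prod_(e | P e) k e (W om e)).
  move=> mk; under eq_fun do rewrite -big_filter.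
  by apply: measurable_prod => e _; apply: measurableT_comp (mk e) (mW e).
(* Induction on the list [r] of coordinates whose factor may be arbitrary; outside [r] the factors
   are indicators. For empty [r] the integrand is the indicator of a rectangle. *)
have ind (r : seq I) : forall (h : I -> X -> R) (b : I -> R),
    (forall e, measurable_fun setT (h e)) -> (forall e x, 0 <= h e x) ->
    (forall e, (\int[nu e]_x (h e x)%:E = (b e)%:E)%E) ->
    (forall e, e \notin r -> exists2 A, measurable A & h e = \1_A) ->
    (\int[m]_om (\1_E om * \prod_e h e (W om e))%:E = (c * \prod_e b e)%:E)%E.
  elim: r => [|e0 r IH] {mh h0 hb}h {}b mh h0 hb hr.
    have /choice[A HA] : forall e, exists A, measurable A /\ h e = \1_A.
      by move=> e; have [A mA hA] := hr e isT; exists A.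
    have mA e : measurable (A e) by have [] := HA e.
    under eq_integral => om _.
      have -> : \1_E om * \prod_e h e (W om e) =
          \1_[set om | E om /\ forall e, A e (W om e)] om.
        rewrite !indicE; case: (boolP (om \in [set om | _])) => [/set_mem[/= Eom AW]|].
          rewrite mem_set// mul1r big1// => e _.
          by have [_ ->] := HA e; rewrite indicE mem_set.
        move=> /negP no; case: (boolP (om \in E)) => [/set_mem Eom|_]; last first.
          by rewrite mul0r.
        rewrite mul1r; have /existsNP[e NAe] : ~ forall e, A e (W om e).
          by move=> AW; apply: no; rewrite inE.
        rewrite (bigD1 e)//=; have [_ ->] := HA e.
        by rewrite indicE memNset// mul0r.
      over.
    rewrite integral_indic//; last first.
      rewrite (_ : [set om | _] =
          E `&` \bigcap_(e in [set: I]) ((fun om => W om e) @^-1` A e)).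
        apply: measurableI => //; apply: fin_bigcap_measurable => // e _.
        by rewrite -[X in measurable X]setTI; exact: mW.
      by apply/seteqP; split=> om /= [? AW]; split=> // e; [move=> _|]; exact: AW.
    rewrite setIT HE//; congr (_ * _)%:E; apply: eq_bigr => e _.
    have := hb e; have [_ ->] := HA e.
    by rewrite integral_indic// setIT => ->.
  have b0 e : 0 <= b e.
    by rewrite -lee_fin -hb integral_ge0// => x _; rewrite lee_fin.
  under eq_integral => om _.
    rewrite (bigD1 e0)//= mulrCA mulrC.
    over.
  rewrite (bigD1 e0)//= mulrCA mulrC EFinM -hb.
  apply: (@ge0_integral_weighted _ _ _ _ _ m (nu e0)
    (fun om => \1_E om * \prod_(e | e != e0) h e (W om e)) (fun om => W om e0)) => //.
  - by apply: measurable_funM => //; exact: mprod.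
  - by move=> om; rewrite mulr_ge0// prodr_ge0.
  - by rewrite mulr_ge0// prodr_ge0.
  (* With all factors but the one at [e0] taken as weight, the image measure of coordinate [e0] is
     tested on [A] by putting [\1_A] in place of [h e0]. This is an instance of the induction
     hypothesis. *)
  move=> A mA.
  pose h' e := if e == e0 then \1_A else h e.
  pose b' e := if e == e0 then fine (nu e0 A) else b e.
  have h'E om : \prod_e h' e (W om e) =
      \1_A (W om e0) * \prod_(e | e != e0) h e (W om e).
    rewrite (bigD1 e0)//= /h' eqxx; congr (_ * _).
    by apply: eq_bigr => e /negbTE ->.
  have b'E : \prod_e b' e = fine (nu e0 A) * \prod_(e | e != e0) b e.
    rewrite (bigD1 e0)//= /b' eqxx; congr (_ * _).
    by apply: eq_bigr => e /negbTE ->.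
  transitivity (\int[m]_om (\1_E om * \prod_e h' e (W om e))%:E)%E.
    by apply: eq_integral => om _; rewrite h'E mulrCA mulrC.
  rewrite (IH h' b').
  - by rewrite b'E mulrCA mulrC EFinM fineK// fin_num_measure.
  - by move=> e; rewrite /h'; case: ifP.
  - by move=> e x; rewrite /h'; case: ifP.
  - move=> e; rewrite /h' /b'; case: eqP => // ->.
    by rewrite integral_indic// setIT fineK// fin_num_measure.
  - move=> e er; rewrite /h'; case: eqP => [_|/eqP ee0]; first by exists A.
    by apply: hr; rewrite in_cons negb_or ee0.
by apply: (ind (enum I)) => // e; rewrite mem_enum.
Qed.

(** * Densities and the Bhattacharyya coefficient *)

Section Densities.
Context {R : realType} {dX : measure_display} {X : measurableType dX}.
Variable mu : {measure set X -> \bar R}.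
Implicit Types (P Q : probability X R) (f g h : X -> R).

Lemma integral_density P f h : is_density mu P f ->
  measurable_fun setT h -> (forall x, 0 <= h x) ->
  (\int[P]_x (h x)%:E = \int[mu]_x (f x * h x)%:E)%E.
Proof.
move=> [f0 [mf Pf]] mh h0; rewrite -[LHS]mul1e; apply/esym.
apply: (@ge0_integral_weighted _ _ _ _ _ mu P f id 1) => // A mA.
rewrite mul1e; transitivity (\int[mu]_(x in A) (f x)%:E)%E; last exact/esym/Pf.
rewrite [RHS]integral_mkcond; apply: eq_integral => x _.
rewrite patchE indicE; case: ifP => _; first by rewrite mulr1.
by rewrite mulr0.
Qed.

(** Used to make the likelihood of the true matching almost surely positive, so that it can be
    divided by. *)
Lemma density_neq0 P f : is_density mu P f -> P [set x | f x != 0] = 1%E.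
Proof.
move=> [f0 [mf Pf]].
have m0 : measurable [set x | f x = 0].
  by have := mf measurableT _ (measurable_set1 0); rewrite setTI.
have P0 : P [set x | f x = 0] = 0%E.
  by rewrite Pf//; apply: integral0_eq => x /= ->.
rewrite (_ : [set x | _] = ~` [set x | f x = 0]); last first.
  by apply/seteqP; split=> x /= /eqP.
by rewrite probability_setC// P0 sube0.
Qed.

Lemma measurable_sqrt : measurable_fun setT (@Num.sqrt R).
Proof. apply: continuous_measurable_fun; exact: sqrt_continuous. Qed.

Lemma measurable_sqrt_ratio f g : measurable_fun setT f ->
  measurable_fun setT g -> (forall x, 0 <= g x) ->
  measurable_fun setT (fun x => Num.sqrt (f x / g x)).
Proof.
move=> mf mg g0; apply: (measurableT_comp measurable_sqrt).
apply: measurable_funM => //.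
(* On nonnegative reals, zero included, the inverse is the real power with exponent -1, which is
   measurable. *)
rewrite (_ : (fun x => (g x)^-1) = (fun x => g x `^ (-1))).
  exact: (measurableT_comp (measurable_powR (-1)) mg).
by apply/funext => x; rewrite powR_inv1.
Qed.

(** Pointwise g sqrt(f/g) = sqrt(fg). Where g vanishes both sides are 0, because division by zero
    gives 0, so absolute continuity is not assumed. *)
Lemma integral_sqrt_ratio P Q f g : is_density mu P f -> is_density mu Q g ->
  (\int[Q]_x (Num.sqrt (f x / g x))%:E = bhattacharyya mu f g)%E.
Proof.
move=> [f0 [mf _]] dg; have [g0 [mg _]] := dg.
rewrite (integral_density _ _ _ dg)//; last exact: measurable_sqrt_ratio.
apply: eq_integral => x _; congr EFin.
have [->|gn0] := eqVneq (g x) 0; first by rewrite mul0r mulr0 sqrtr0.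
rewrite -{1}(ger0_norm (g0 x)) -sqrtr_sqr -sqrtrM ?sqr_ge0//.
by congr Num.sqrt; rewrite expr2 mulrACA mulfV// mulr1 mulrC.
Qed.

Lemma bhattacharyyaC f g : bhattacharyya mu f g = bhattacharyya mu g f.
Proof. by apply: eq_integral => x _; rewrite mulrC. Qed.

(** The pointwise bound sqrt(fg) <= f + g shows that the coefficient is at most 2, so it can be
    handled as a real number. *)
Lemma bhattacharyya_fin P Q f g : is_density mu P f -> is_density mu Q g ->
  exists2 b : R, 0 <= b & bhattacharyya mu f g = b%:E.
Proof.
move=> [f0 [mf Pf]] [g0 [mg Qg]].
have B0 : (0 <= bhattacharyya mu f g)%E.
  by apply: integral_ge0 => x _; rewrite lee_fin sqrtr_ge0.
have B2 : (bhattacharyya mu f g <= 2%:E)%E.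
  apply: (@le_trans _ _ (\int[mu]_x ((f x)%:E + (g x)%:E))%E).
    rewrite /bhattacharyya; apply: ge0_le_integral => //.
    - apply/measurable_EFinP; apply: (measurableT_comp measurable_sqrt).
      exact: measurable_funM.
    - by apply: emeasurable_funD; apply/measurable_EFinP.
    - move=> x _; rewrite -EFinD lee_fin -(@ler_pXn2r _ 2)// ?nnegrE ?sqrtr_ge0//.
        rewrite sqr_sqrtr ?mulr_ge0// sqrrD.
        by move: (f0 x) (g0 x) => fx0 gx0; nra.
      by rewrite addr_ge0.
  rewrite ge0_integralD//; last 4 first.
  - by move=> x _; rewrite lee_fin.
  - exact/measurable_EFinP.
  - by move=> x _; rewrite lee_fin.
  - exact/measurable_EFinP.
  by rewrite -Pf// -Qg// !probability_setT -EFinD.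
exists (fine (bhattacharyya mu f g)); first exact: fine_ge0.
by rewrite fineK// ge0_fin_numE// (le_lt_trans B2)// ltry.
Qed.

End Densities.

(** * Counting permutations by their number of disagreements *)

Section Matchings.
Context {n : nat}.
Implicit Types (s t : {perm 'I_n}) (G : {set 'I_n * 'I_n}).

Definition ndiff s t : nat := #|[set i | s i != t i]%SET|.

Lemma ndiffC s t : ndiff s t = ndiff t s.
Proof. by apply: eq_card => i; rewrite !inE eq_sym. Qed.

Lemma mem_matching s (e : 'I_n * 'I_n) : (e \in matching_of s) = (s e.1 == e.2).
Proof.
apply/imsetP/eqP => [[i _ ->]//|]; case: e => i j /= <-.
by exists i.
Qed.

Lemma card_matching s : #|matching_of s| = n.
Proof. by rewrite card_imset ?card_ord// => i j []. Qed.

Lemma card_matchingD s t : #|matching_of s :\: matching_of t| = ndiff s t.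
Proof.
rewrite /ndiff -(card_imset _ (_ : injective (fun i => (i, s i)))); last first.
  by move=> i j [].
apply: eq_card => -[i j]; rewrite !inE !mem_matching/=.
apply/andP/imsetP => [[tij /eqP sij]|[k]].
  by exists i; [rewrite inE sij eq_sym|rewrite sij].
by rewrite inE => /negbTE stk [-> ->]; rewrite eq_sym stk eqxx.
Qed.

Lemma card_matching_symdiff s t :
  #|(matching_of s :\: matching_of t) :|: (matching_of t :\: matching_of s)|
  = (2 * ndiff s t)%N.
Proof.
rewrite cardsU !card_matchingD (ndiffC t) mul2n -addnn.
rewrite (_ : _ :&: _ = finset.set0) ?cards0 ?subn0//.
by apply/setP => e; rewrite !inE; case: (e \in _); rewrite ?andbF.
Qed.

Lemma lossE (R : realType) s t : loss s t = (2 * ndiff s t)%:R / n%:R :> R.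
Proof. by rewrite /loss card_matching_symdiff. Qed.

(** There are C(n,k) choices for the disagreement set S. Given S, the map sending t to [t * s^-1] is
    injective into the permutations that fix every point outside S, of which there are k!. *)
Lemma card_ndiff_leq s k : (#|[set t | ndiff s t == k]%SET| <= n ^_ k)%N.
Proof.
rewrite -bin_ffact -[in 'C(n, k)](card_ord n) -card_draws mulnC.
pose D t := [set i | s i != t i]%SET.
rewrite -sum1_card (partition_big D (fun S => S \in [set S : {set 'I_n} | #|S| == k]%SET));
  last by move=> t; rewrite !inE.
rewrite mulnC -sum_nat_const; apply: leq_sum => S; rewrite inE => /eqP SE.
rewrite sum1_card -SE -card_perm -(card_imset _ (mulIg s^-1)%g).
apply/subset_leq_card/fintype.subsetP => u /imsetP[t].
rewrite unfold_in => /andP[_ /eqP DS] ->; apply/fintype.subsetP => i.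
rewrite !inE permM -DS inE; apply: contra => /eqP <-.
by rewrite permK.
Qed.

End Matchings.

(** * The law of the unweighted graph *)

Section MatchingSums.
Context {R : realType} {n : nat}.
Implicit Types (s t : {perm 'I_n}) (G : {set 'I_n * 'I_n}) (d : R).

Lemma graph_prob_ge0 d s G : 0 <= d <= n%:R -> 0 <= graph_prob d s G.
Proof.
move=> /andP[d0 dn]; rewrite /graph_prob.
have [n0|n0] := posnP n.
  by subst n; rewrite /graph_prob invr0 mulr0 subr0 !mulr_ge0// exprn_ge0.
rewrite !mulr_ge0// exprn_ge0//; first by rewrite divr_ge0.
by rewrite subr_ge0 ler_pdivrMr ?ltr0n// mul1r.
Qed.

(** Both matchings have n edges, so G has equally many edges outside either one. The graph factor
    therefore cancels from likelihood ratios. *)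
Lemma graph_probC d s t G : matching_of s \subset G -> matching_of t \subset G ->
  graph_prob d s G = graph_prob d t G.
Proof.
move=> sG tG; rewrite /graph_prob sG tG.
suff -> : #|G :\: matching_of s| = #|G :\: matching_of t| by [].
by rewrite !cardsD (finset.setIidPr sG) (finset.setIidPr tG) !card_matching.
Qed.

(** This is the probability that G contains the matching of t when s is planted: each of the
    [ndiff s t] edges of t outside s must be present, with probability d/n each. *)
Lemma sum_graph_prob d s t :
  \sum_(G : {set 'I_n * 'I_n}) (matching_of t \subset G)%:R * graph_prob d s G
    = (d / n%:R) ^+ ndiff s t.
Proof.
set p := d / n%:R.
set Ms := matching_of s; set Mt := matching_of t.
pose F e := if e \in Ms then 1 else p.
pose H e : R := if (e \in Ms) || (e \in Mt) then 0 else 1 - p.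
(* [F] and [H] weigh the presence and the absence of an edge, absence being forbidden on both
   matchings. Expanding the product gives one term per graph G, the set of edges where [F] is
   chosen. *)
transitivity (\prod_e (F e + H e)).
  rewrite bigA_distr; apply: eq_bigr => G _.
  rewrite /graph_prob -/Ms -/p.
  have [MsG|/subsetPn[e eMs eG]] := boolP (Ms \subset G); last first.
    by rewrite !mul0r mulr0 (bigD1 e)//= (negbTE eG) /H eMs mul0r.
  have [MtG|/subsetPn[e eMt eG]] := boolP (Mt \subset G); last first.
    by rewrite mul0r (bigD1 e)//= (negbTE eG) /H eMt orbT mul0r.
  rewrite !mul1r (bigID [in Ms])/= big1 ?mul1r; last first.
    by move=> e eMs; rewrite (fintype.subsetP MsG)// /F eMs.
  rewrite (bigID [in G])/=; congr (_ * _).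
    rewrite (eq_bigr (fun=> p)); last first.
      by move=> e /andP[/negbTE eMs eG]; rewrite eG /F eMs.
    by rewrite prodr_const; congr (_ ^+ _); apply: eq_card => e; rewrite !inE.
  rewrite (eq_bigr (fun=> 1 - p)); last first.
    move=> e /andP[/negbTE eMs eG]; rewrite (negbTE eG) /H eMs/=.
    by rewrite ifN//; apply: contra eG; exact: (fintype.subsetP MtG).
  rewrite prodr_const; congr (_ ^+ _).
  (* Once G contains the planted matching, every absent edge is unplanted, so the exponent n(n-1) -
     |G \ Ms| equals n^2 - |G|. *)
  have -> : #|[pred e | e \notin Ms & e \notin G]| = #|~: G|.
    apply: eq_card => e; rewrite !inE andb_idl//.
    by apply: contra; exact: (fintype.subsetP MsG).
  have := cardsC G; rewrite card_prod card_ord cardsD (finset.setIidPr MsG) card_matching.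
  have := subset_leq_card MsG; rewrite card_matching mulnBr muln1.
  by lia.
rewrite (bigID [in Mt :\: Ms])/= -[RHS]mulr1; congr (_ * _).
  rewrite (eq_bigr (fun=> p)).
    by rewrite prodr_const ndiffC -card_matchingD.
  move=> e; rewrite inE => /andP[/negbTE eMs eMt].
  by rewrite /F /H eMs eMt addr0.
apply: big1 => e; rewrite inE negb_and negbK /F /H.
case: (e \in Ms) => /=; first by rewrite addr0.
by move=> /negbTE ->; rewrite subrKC.
Qed.
End MatchingSums.

(** * Probability that the estimator outputs a given wrong matching *)

Section PairwiseError.
Context {R : realType} {n : nat} {dX : measure_display} {X : measurableType dX}.
Implicit Types (s t : {perm 'I_n}) (G : {set 'I_n * 'I_n}) (d : R).

(* Where both densities are positive, the product over e of these factors is the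
   square root of the likelihood ratio of t to s. *)
Definition sqrt_ratio (f g : X -> R) s t (e : 'I_n * 'I_n) (x : X) : R :=
  if e \in matching_of t :\: matching_of s then Num.sqrt (f x / g x)
  else if e \in matching_of s :\: matching_of t then Num.sqrt (g x / f x)
  else 1.

(** The likelihood of s is positive here, hence so is that of t, which forces the matching of t into
    G. The graph factors then cancel, and the square of the product is the remaining ratio. *)
Lemma prod_sqrt_ratio_ge1 d (f g : X -> R) G (w : 'I_n * 'I_n -> X) s t :
  (forall x, 0 <= f x) -> (forall x, 0 <= g x) -> 0 < graph_prob d s G ->
  (forall e, if e \in matching_of s then f (w e) != 0 else g (w e) != 0) ->
  likelihood d f g G w s <= likelihood d f g G w t ->
  (matching_of t \subset G) /\ 1 <= \prod_e sqrt_ratio f g s t e (w e).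
Proof.
move=> f0 g0 gp0 nz.
(* The factor contributed by edge e to the likelihood of u, set to 1 off G so that the product runs
   over all edges. *)
pose phi u e := if e \in matching_of u then f (w e)
                else if e \in G then g (w e) else 1.
have likE u : likelihood d f g G w u = graph_prob d u G * \prod_e phi u e.
  rewrite /likelihood -mulrA; case: (boolP (matching_of u \subset G)) => uG; last first.
    by rewrite /graph_prob (negbTE uG) !mul0r.
  congr (_ * _); rewrite [RHS](bigID [in matching_of u])/=; congr (_ * _).
    by apply: eq_bigr => e eu; rewrite /phi eu.
  rewrite [RHS](bigID [in G])/= [X in _ = _ * X]big1 ?mulr1.
    apply: eq_big => [e|e]; rewrite inE// => /andP[/negbTE eu eG].
    by rewrite /phi eu eG.
  by move=> e /andP[/negbTE eu /negbTE eG]; rewrite /phi eu eG.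
have phis0 e : 0 < phi s e.
  rewrite /phi; have := nz e; case: ifP => _ fg0; first by rewrite lt0r fg0 f0.
  by case: ifP => // _; rewrite lt0r fg0 g0.
have phit0 e : 0 <= phi t e by rewrite /phi; do 2 case: ifP => // _.
rewrite !likE => lest.
have Ls : 0 < \prod_e phi s e by apply: prodr_gt0 => e _.
have sG : matching_of s \subset G.
  by apply: contraLR gp0 => /negbTE sG; rewrite /graph_prob sG !mul0r ltxx.
have tG : matching_of t \subset G.
  apply: contraLR (lt_le_trans (mulr_gt0 gp0 Ls) lest) => /negbTE tG.
  by rewrite /graph_prob tG !mul0r ltxx.
split=> //.
have ratioE e : sqrt_ratio f g s t e (w e) ^+ 2 = phi t e / phi s e.
  have := phis0 e; rewrite /sqrt_ratio /phi !inE.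
  case: (boolP (e \in matching_of s)) => es; case: (boolP (e \in matching_of t)) => et /=.
  - by move=> fe; rewrite expr1n mulfV// gt_eqF.
  - by rewrite sqr_sqrtr ?divr_ge0// (fintype.subsetP sG).
  - by rewrite sqr_sqrtr ?divr_ge0// (fintype.subsetP tG).
  - by move=> fe; rewrite expr1n mulfV// gt_eqF.
have ratio0 : 0 <= \prod_e sqrt_ratio f g s t e (w e).
  by apply: prodr_ge0 => e _; rewrite /sqrt_ratio; do 2 case: ifP => //.
rewrite -(@ler_pXn2r _ 2) ?nnegrE// expr1n -prodrXl.
under eq_bigr do rewrite ratioE.
rewrite prodf_div lter_pdivlMr// mul1r.
by move: lest; rewrite (graph_probC d s t G)// ler_pM2l// -(graph_probC d s t G).
Qed.

(** Markov's inequality for the product of the [sqrt_ratio] factors, with G held fixed: the weights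
    are independent given s and G, so the expectation is a product over edges. Summation over G is
    left for later. *)
Lemma ML_pair_graph_bound d (P Q : probability X R)
    (mu : {measure set X -> \bar R}) (f g : X -> R) (b : R)
    (dO : measure_display) (Om : measurableType dO) (Pr : probability Om R)
    (Ms : Om -> {perm 'I_n}) (Gr : Om -> {set 'I_n * 'I_n})
    (W : Om -> 'I_n * 'I_n -> X) est s t G :
  is_density mu P f -> is_density mu Q g -> 0 <= d <= n%:R ->
  bhattacharyya mu f g = b%:E ->
  planted_model d P Q Pr Ms Gr W ->
  ML_estimator d f g est ->
  measurable [set om | est (Gr om) (W om) = t] ->
  (Pr [set om | [/\ Ms om = s, Gr om = G & est (Gr om) (W om) = t]] <=
   (n`!%:R^-1 * ((matching_of t \subset G)%:R * graph_prob d s G)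
     * (b ^+ 2) ^+ ndiff s t)%:E)%E.
Proof.
move=> df dg dn bE [mMs [mGr [mW model]]] [_ ML] mest.
have [f0 [mf _]] := df; have [g0 [mg _]] := dg.
have gp0 := graph_prob_ge0 d s G dn.
have b0 : 0 <= b.
  by rewrite -lee_fin -bE; apply: integral_ge0 => x _; rewrite lee_fin sqrtr_ge0.
set c := n`!%:R^-1 * graph_prob d s G.
have c0 : 0 <= c by rewrite mulr_ge0.
pose nu (e : 'I_n * 'I_n) := if e \in matching_of s then P else Q.
pose E := [set om | Ms om = s] `&` [set om | Gr om = G].
have mE : measurable E by apply: measurableI; [exact: mMs|exact: mGr].
have rectE A : (forall e, measurable (A e)) ->
    Pr [set om | E om /\ forall e, A e (W om e)] =
    (c * \prod_e fine (nu e (A e)))%:E.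
  move=> mA; rewrite -[RHS]/((_ * _)%:E) /c.
  transitivity (Pr [set om | Ms om = s /\ Gr om = G /\ forall e, A e (W om e)]).
    congr (Pr _); apply/seteqP; split=> om /=; first by move=> [[? ?] ?].
    by move=> [? [? ?]].
  rewrite model//; congr (_ * _)%:E; apply: eq_bigr => e _.
  by rewrite /nu; case: ifP.
pose A (e : 'I_n * 'I_n) :=
  if e \in matching_of s then [set x | f x != 0] else [set x | g x != 0].
have mneq0 (h : X -> R) : measurable_fun setT h -> measurable [set x | h x != 0].
  move=> mh; have := mh measurableT _ (measurableC (measurable_set1 0)).
  rewrite setTI; congr measurable.
  by apply/seteqP; split=> x /= /eqP.
have mA e : measurable (A e) by rewrite /A; case: ifP => _; exact: mneq0.
(* B is E minus the null event that the likelihood of the truth vanishes. *)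
pose B := [set om | E om /\ forall e, A e (W om e)].
have BE : Pr B = c%:E.
  rewrite rectE// big1 ?mulr1// => e _; rewrite /nu /A; case: ifP => _.
    by rewrite (density_neq0 mu P f).
  by rewrite (density_neq0 mu Q g).
have EE : Pr E = c%:E.
  have := rectE (fun=> setT) (fun=> measurableT).
  under [X in _ = (_ * X)%:E]eq_bigr do rewrite probability_setT.
  rewrite big1// mulr1 => <-; congr (Pr _).
  by apply/seteqP; split=> om //= [].
have mB : measurable B.
  rewrite (_ : B = E `&`
      \bigcap_(e in [set: 'I_n * 'I_n]) ((fun om => W om e) @^-1` A e)).
    apply: measurableI => //; apply: fin_bigcap_measurable => // e _.
    by rewrite -[X in measurable X]setTI; exact: mW.
  by apply/seteqP; split=> om /= [? AW]; split=> // e; [move=> _|]; exact: AW.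
have BsubE : B `<=` E by move=> om [].
have EDB : Pr (E `\` B) = 0%E.
  transitivity (Pr E - Pr B)%E; last by rewrite EE BE subee.
  rewrite measureD//; first by rewrite (setIidr BsubE).
  by rewrite (le_lt_trans (probability_le1 Pr mE))// ltry.
set F := [set om | _].
have FE : F = E `&` [set om | est (Gr om) (W om) = t].
  by apply/seteqP; split=> om; [move=> [? ? ?]|move=> [[? ?] ?]].
have mF : measurable F by rewrite FE; exact: measurableI.
(* F is covered by its intersection with B and the null set E minus B. *)
have FleFB : (Pr F <= Pr (F `&` B))%E.
  rewrite -[leRHS]adde0 -EDB; apply: le_trans (measureU2 _ _ _); last 2 first.
  - exact: measurableI.
  - exact: measurableD.
  rewrite le_measure ?inE//; first by apply: measurableU; [exact: measurableI|exact: measurableD].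
  move=> om Fom; have [Bom|nBom] := pselect (B om); [by left|right].
  by split=> //; move: Fom; rewrite FE => -[].
have FleE : (Pr F <= c%:E)%E by rewrite -EE le_measure ?inE// FE => om [].
have [gp1|gp1] := eqVneq (graph_prob d s G) 0.
  by move: FleE; rewrite /c gp1 !mulr0 mul0r.
have {}gp1 : 0 < graph_prob d s G by rewrite lt0r gp1.
have FB om : F om -> B om -> (matching_of t \subset G) /\
    1 <= \prod_e sqrt_ratio f g s t e (W om e).
  rewrite FE => -[[sE GE] tE] [_ AW]; apply: (prod_sqrt_ratio_ge1 d) => //.
    by move=> e; have := AW e; rewrite /A; case: ifP.
  rewrite /= in sE GE tE; rewrite -[X in _ <= likelihood _ _ _ _ _ X]tE GE.
  exact: ML.
apply: (le_trans FleFB).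
have [tG|tG] := boolP (matching_of t \subset G); last first.
  rewrite mul0r mulr0 mul0r (_ : F `&` B = set0) ?measure0//.
  by rewrite -subset0 => om [/FB H /H[]]; rewrite (negbTE tG).
rewrite mul1r -/c.
(* The mean of each factor: b on the symmetric difference of the matchings, which has 2 [ndiff s t]
   edges, and 1 elsewhere. *)
pose bb e := if e \in (matching_of t :\: matching_of s) then b
   else if e \in (matching_of s :\: matching_of t) then b else 1.
have -> : (b ^+ 2) ^+ ndiff s t = \prod_e bb e.
  rewrite (bigID [in matching_of t :\: matching_of s])/=.
  rewrite (eq_bigr (fun=> b)); last by move=> e; rewrite /bb => ->.
  rewrite [X in _ * X](bigID [in matching_of s :\: matching_of t])/=.
  rewrite [X in _ * (X * _)](eq_bigr (fun=> b)); last first.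
    by move=> e /andP[h1 h2]; rewrite /bb (negbTE h1) h2.
  rewrite [X in _ * (_ * X)]big1 ?mulr1; last first.
    by move=> e /andP[/negbTE h1 /negbTE h2]; rewrite /bb h1 h2.
  rewrite !prodr_const card_matchingD (ndiffC t).
  have -> : #|[pred e | e \notin matching_of t :\: matching_of s
      & e \in matching_of s :\: matching_of t]| = ndiff s t.
    rewrite -card_matchingD; apply: eq_card => e; rewrite !inE.
    by case: (e \in matching_of s); rewrite ?andbF//= andbT andbC andbb.
  by rewrite -exprD -exprM mul2n addnn.
have msr e : measurable_fun setT (sqrt_ratio f g s t e).
  rewrite /sqrt_ratio; case: (e \in _); first exact: measurable_sqrt_ratio.
  by case: (e \in _); [exact: measurable_sqrt_ratio|exact: measurable_cst].
have sr0 e x : 0 <= sqrt_ratio f g s t e x.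
  by rewrite /sqrt_ratio; do 2 case: ifP => //.
(* An edge of t alone has weight law Q and factor sqrt(f/g); an edge of s alone has law P and factor
   sqrt(g/f). Both means are the Bhattacharyya coefficient. *)
have srI e : (\int[nu e]_x (sqrt_ratio f g s t e x)%:E = (bb e)%:E)%E.
  rewrite /sqrt_ratio /bb /nu !inE.
  case: (e \in matching_of s); case: (e \in matching_of t) => /=.
  - by rewrite integral_cst// mul1e; exact: probability_setT.
  - by rewrite (integral_sqrt_ratio mu Q P g f)// bhattacharyyaC.
  - by rewrite (integral_sqrt_ratio mu P Q f g).
  - by rewrite integral_cst// mul1e; exact: probability_setT.
have <- := integral_prod_rectangles _ _ _ _ _ _ Pr W nu E c mE mW c0 rectE _ bb
  msr sr0 srI.
rewrite -[X in Pr X]setIT -integral_indic//; last exact: measurableI.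
apply: ge0_le_integral => //.
- by apply/measurable_EFinP; apply: measurable_indic; exact: measurableI.
- apply/measurable_EFinP; apply: measurable_funM => //.
  apply: measurable_prod => e _; exact: (measurableT_comp (msr e) (mW e)).
move=> om _; rewrite lee_fin [leLHS]indicE.
case: (boolP (om \in F `&` B)) => [/set_mem[Fom Bom]|_]; last first.
  by rewrite mulr_ge0// prodr_ge0.
rewrite indicE mem_set ?mul1r; last exact: BsubE.
by have [] := FB _ Fom Bom.
Qed.

End PairwiseError.

(** * Numerical estimates for the terms of the union bound *)

(** The left side is the product of 1 - j/n over j < k. Each factor is at most exp(-j/n), and the j
    sum to k(k-1)/2. *)
Lemma ffact_ratio_le (R : realType) (n k : nat) : (0 < n)%N ->
  (n ^_ k)%:R / n%:R ^+ k
    <= expR (- (k%:R * (k%:R - 1) / (2 * n%:R))) :> R.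
Proof.
move=> n0; have n0' : 0 < n%:R :> R by rewrite ltr0n.
elim: k => [|k IH]; first by rewrite mul0r mul0r oppr0 expR0 ffactn0 expr0 divr1.
have step : (n - k)%:R / n%:R <= expR (- (k%:R / n%:R)) :> R.
  (* For k > n the truncated difference n - k is 0. *)
  have [kn|/ltnW nk] := leqP k n; last first.
    by move: nk; rewrite -subn_eq0 => /eqP ->; rewrite mul0r expR_ge0.
  rewrite natrB// mulrBl divff ?gt_eqF//; exact: expR_ge1Dx.
rewrite ffactnSr natrM exprSr invfM mulrACA.
have -> : - (k.+1%:R * (k.+1%:R - 1) / (2 * n%:R)) =
    - (k%:R * (k%:R - 1) / (2 * n%:R)) + - (k%:R / n%:R) :> R.
  by rewrite -natr1; field; rewrite gt_eqF.
by rewrite expRD ler_pM// divr_ge0// exprn_ge0.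
Qed.

(** From exp(-x) >= 1 - x at x = ln n, where 1/n <= 1/2. *)
Lemma ln_nat_ge (R : realType) (n : nat) : (2 <= n)%N -> 2^-1 <= ln n%:R :> R.
Proof.
move=> n2; have n0 : 0 < n%:R :> R by rewrite ltr0n (leq_trans _ n2).
have := expR_ge1Dx (- ln n%:R : R).
rewrite expRN lnK ?posrE// => h.
have : n%:R^-1 <= 2^-1 :> R by rewrite lef_pV2 ?posrE// (ler_nat R 2).
by move: h; move: (ln _) (_^-1) => u v; lra.
Qed.

(** Write x for k and L for ln n. The exponent is at most 2x ln a - x^2/2n + x/2n. As x >= 8n ln a,
    the first term is at most x^2/4n; as x >= 8n sqrt(L/n), x^2/n >= 64L. What remains is at most
    -16L + 1/2, which is below -2L because L >= 1/2. *)
Lemma tail_term_le (R : realType) (n k : nat) (a m : R) : (2 <= n)%N -> 1 <= a ->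
  ln a <= m -> Num.sqrt (ln n%:R / n%:R) <= m -> 8 * n%:R * m <= k%:R ->
  (n ^_ k)%:R * (a ^+ 2 / n%:R) ^+ k <= n%:R ^- 2.
Proof.
move=> n2 a1 am sm mk.
have n0 : (0 < n)%N by exact: leq_trans n2.
have n0' : 0 < n%:R :> R by rewrite ltr0n.
have a0 : 0 < a by exact: lt_le_trans a1.
have L2 := ln_nat_ge R n n2.
have m0 : 0 <= m by apply: le_trans sm; exact: sqrtr_ge0.
have Lm : ln n%:R / n%:R <= m ^+ 2.
  rewrite -[leLHS]sqr_sqrtr ?ler_pXn2r ?nnegrE ?sqrtr_ge0//.
  by rewrite divr_ge0// (le_trans _ L2).
set L := ln n%:R in L2 Lm *.
set x : R := k%:R in mk *.
(* Above n the falling factorial vanishes, so x/n <= 1 may be assumed. *)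
have kle : k%:R <= n%:R :> R \/ (n ^_ k)%:R = 0 :> R.
  have [kn|nk] := leqP k n; first by left; rewrite ler_nat.
  by right; rewrite ffact_small.
case: kle => [kn|->]; last by rewrite mul0r invr_ge0 exprn_ge0.
have -> : (n ^_ k)%:R * (a ^+ 2 / n%:R) ^+ k =
    ((n ^_ k)%:R / n%:R ^+ k) * expR (2 * x * ln a).
  have -> : expR (2 * x * ln a) = (a ^+ 2) ^+ k.
    by rewrite -mulrA mulrCA expRM_natl mulr_natl mulr2n expRD lnK// expr2.
  by rewrite expr_div_n mulrCA mulrC.
have -> : n%:R ^- 2 = expR (- (2 * L)).
  by rewrite expRN expRM_natl lnK.
apply: (@le_trans _ _ (expR (- (x * (x - 1) / (2 * n%:R))) * expR (2 * x * ln a))).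
  by rewrite ler_wpM2r ?expR_ge0// ffact_ratio_le.
rewrite -expRD ler_expR.
have x0 : 0 <= x by exact: ler0n.
have e1 : 2 * x * ln a <= x ^+ 2 / (4 * n%:R).
  rewrite ler_pdivlMr ?mulr_gt0//.
  have := ler_wpM2l x0 mk; have := ler_wpM2l x0 (ler_wpM2l (ltW n0') am).
  nra.
have e2 : 64 * L <= x ^+ 2 / n%:R.
  rewrite ler_pdivlMr//.
  have mk2 : (8 * n%:R * m) ^+ 2 <= x ^+ 2 by rewrite ler_pXn2r ?nnegrE ?mulr_ge0// ltW.
  move: Lm; rewrite ler_pdivrMr// => Lm.
  have := ler_wpM2l (ltW n0') Lm; nra.
have e3 : x / n%:R <= 1 by rewrite ler_pdivrMr// mul1r.
have -> : x * (x - 1) / (2 * n%:R) = x ^+ 2 / n%:R / 2 - x / n%:R / 2.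
  by field; rewrite gt_eqF.
have e1' : x ^+ 2 / (4 * n%:R) = x ^+ 2 / n%:R / 4 by field; rewrite gt_eqF.
move: e1 e2 e3; rewrite e1'.
move: (x ^+ 2 / _) (x / _) (2 * x * ln a) => u v w; lra.
Qed.

(** * The expected loss as a finite sum, and the union bound *)

Lemma integral_finite_rv (R : realType) (dO : measure_display)
    (Om : measurableType dO) (m : probability Om R) (T : finType)
    (Z : Om -> T) (phi : T -> R) :
  (forall z, measurable [set om | Z om = z]) -> (forall z, 0 <= phi z) ->
  (\int[m]_om (phi (Z om))%:E
     = (\sum_z phi z * fine (m [set om | Z om = z]))%:E)%E.
Proof.
move=> mZ phi0.
transitivity (\int[m]_om (\sum_z (phi z)%:E * (\1_[set om | Z om = z] om)%:E))%E.
  apply: eq_integral => om _; rewrite (bigD1 (Z om))//= big1 ?adde0; last first.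
    move=> z zZ; rewrite indicE memNset ?mule0// => /= Zz.
    by rewrite Zz eqxx in zZ.
  by rewrite indicE mem_set// mule1.
rewrite ge0_integral_sum//.
- rewrite -sumEFin; apply: eq_bigr => z _.
  rewrite ge0_integralZl_EFin//.
    by rewrite integral_indic// setIT EFinM fineK// fin_num_measure.
  exact/measurable_EFinP/measurable_indic.
- move=> z; apply: measurable_funeM; exact/measurable_EFinP/measurable_indic.
- by move=> z om _; rewrite -EFinM lee_fin mulr_ge0.
Qed.

Lemma ndiff_leq n (s t : {perm 'I_n}) : (ndiff s t <= n)%N.
Proof. by rewrite -[leqRHS]card_ord max_card. Qed.

Lemma sum_perm_ndiff_le (R : realType) (n : nat) (s : {perm 'I_n}) (K r : R) :
  0 <= r ->
  \sum_(t | K <= (ndiff s t)%:R) r ^+ ndiff s t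
    <= \sum_(k < n.+1 | K <= k%:R) (n ^_ k)%:R * r ^+ k.
Proof.
move=> r0; pose D t : 'I_n.+1 := inord (ndiff s t).
have DE t : D t = ndiff s t :> nat by rewrite inordK// ltnS ndiff_leq.
rewrite (partition_big D (fun k : 'I_n.+1 => K <= k%:R)); last first.
  by move=> t; rewrite DE.
apply: ler_sum => k _; rewrite (eq_bigr (fun=> r ^+ k)); last first.
  by move=> t /andP[_ /eqP <-]; rewrite DE.
rewrite sumr_const -[leLHS]mulr_natl ler_wpM2r ?exprn_ge0// ler_nat.
apply: leq_trans (card_ndiff_leq s k); apply/subset_leq_card/fintype.subsetP => t.
by rewrite unfold_in inE -DE => /andP[_ /eqP ->].
Qed.

Theorem theorem1 (R : realType) :
  exists C : R, 0 < C /\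
  forall (dX : measure_display) (X : measurableType dX)
         (d eps : nat -> R) (P Q : nat -> probability X R),
  exists n0 : nat, forall n : nat, (n0 <= n)%N ->
  forall (mu : {measure set X -> \bar R}) (f g : X -> R),
    is_density mu (P n) f -> is_density mu (Q n) g ->
    0 <= d n <= n%:R -> 0 <= eps n ->
    ((Num.sqrt (d n))%:E * bhattacharyya mu f g <= (1 + eps n)%:E)%E ->
  forall (dO : measure_display) (Om : measurableType dO) (Pr : probability Om R)
         (Ms : Om -> {perm 'I_n}) (Gr : Om -> {set 'I_n * 'I_n})
         (W : Om -> 'I_n * 'I_n -> X),
    planted_model (d n) (P n) (Q n) Pr Ms Gr W ->
  forall est : {set 'I_n * 'I_n} -> ('I_n * 'I_n -> X) -> {perm 'I_n},
    ML_estimator (d n) f g est ->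
    (forall t, measurable [set om | est (Gr om) (W om) = t]) ->
    (\int[Pr]_om (loss (Ms om) (est (Gr om) (W om)))%:E
      <= (C * Num.max (ln (1 + eps n)) (Num.sqrt (ln n%:R / n%:R)))%:E)%E.
Proof.
(* Matchings with fewer than K = 8 n m disagreements contribute at most
   2 K / n = 16 m to the loss, the others at most 4 / n <= 4 m. *)
exists 20; split=> // dX X d eps P Q; exists 2%N => n n2 mu f g df dg dn e0.
have [b b0 bE] := bhattacharyya_fin mu (P n) (Q n) f g df dg.
rewrite bE -EFinM lee_fin => dbe dO Om Pr Ms Gr W model est ML mest.
move: (d n) dn dbe model ML => {}d dn dbe model ML.
set a := 1 + eps n in dbe *.
set m := Num.max _ _.
have n0 : (0 < n)%N by exact: leq_trans n2.
have n0' : 0 < n%:R :> R by rewrite ltr0n.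
have a1 : 1 <= a by rewrite lerDl.
have am : ln a <= m by rewrite le_max lexx.
have sm : Num.sqrt (ln n%:R / n%:R) <= m by rewrite le_max lexx orbT.
have m0 : 0 <= m by apply: le_trans sm; exact: sqrtr_ge0.
have d0 : 0 <= d by case/andP: dn.
set K := 8 * n%:R * m.
set r := d / n%:R * b ^+ 2.
have r0 : 0 <= r by rewrite mulr_ge0 ?divr_ge0// exprn_ge0.
(* The assumption on sqrt(d) B, squared and divided by n. *)
have ra : r <= a ^+ 2 / n%:R.
  rewrite /r mulrAC ler_pM2r ?invr_gt0//.
  rewrite -[d]sqr_sqrtr// -exprMn ler_pXn2r ?nnegrE//.
    by rewrite mulr_ge0// sqrtr_ge0.
  exact: le_trans a1.
(* The triple of truth, graph and estimate takes finitely many values, so the expected loss is a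
   finite sum against its law [q]. *)
pose Z om : {perm 'I_n} * {set 'I_n * 'I_n} * {perm 'I_n} :=
  (Ms om, Gr om, est (Gr om) (W om)).
pose q z := fine (Pr [set om | Z om = z]).
have q0 z : 0 <= q z by apply: fine_ge0; exact: measure_ge0.
have ZE s G t : [set om | Z om = (s, G, t)] =
    [set om | [/\ Ms om = s, Gr om = G & est (Gr om) (W om) = t]].
  by apply/seteqP; split=> om /=; [move=> []|move=> [<- <- <-]].
have mZ z : measurable [set om | Z om = z].
  case: z => -[s G] t; rewrite ZE.
  rewrite (_ : [set om | _] = [set om | Ms om = s] `&` [set om | Gr om = G] `&`
     [set om | est (Gr om) (W om) = t]).
    have [mMs [mGr _]] := model.
    by do 2 apply: measurableI => //.
  by apply/seteqP; split=> om /=; [move=> []|move=> [[]]].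
have q1 : \sum_z q z = 1.
  apply/EFin_inj; rewrite -(probability_setT Pr) -[RHS]mul1e -integral_cst//.
  rewrite (integral_finite_rv _ _ _ Pr _ Z (fun=> 1))//.
  by congr EFin; apply: eq_bigr => z _; rewrite mul1r.
have qle s G t : q (s, G, t) <= n`!%:R^-1 *
    ((matching_of t \subset G)%:R * graph_prob d s G) * (b ^+ 2) ^+ ndiff s t.
  rewrite -lee_fin fineK ?fin_num_measure// ZE.
  exact: (ML_pair_graph_bound d (P n) (Q n) mu f g).
rewrite (integral_finite_rv _ _ _ Pr _ Z (fun z => loss z.1.1 z.2))//; last first.
  by move=> z; rewrite lossE divr_ge0.
rewrite lee_fin -/q.
(* Below K disagreements the loss is at most 2K/n = 16m; otherwise it is at most 2. *)
have lossle z : loss z.1.1 z.2 * q z <=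
    16 * m * q z + 2 * (if K <= (ndiff z.1.1 z.2)%:R then q z else 0).
  rewrite lossE natrM; case: (lerP K) => Kn; last first.
    rewrite mulr0 addr0 ler_wpM2r// ler_pdivrMr// (_ : 16 * m * _ = 2 * K).
      by rewrite ler_wpM2l// ltW.
    by rewrite /K; ring.
  rewrite -mulrDl ler_wpM2r// -[leLHS]add0r lerD ?mulr_ge0//.
  by rewrite ler_pdivrMr// ler_wpM2l// ler_nat ndiff_leq.
apply: (le_trans (ler_sum _ (fun z _ => lossle z))).
rewrite big_split/= -mulr_sumr q1 mulr1 -mulr_sumr -big_mkcond/=.
(* Summing over G turns the graph factor into (d/n)^k, which joins (b^2)^k to form r^k. The at most
   n + 1 values of k contribute n^-2 each, and (n+1)/n^2 <= 2/n. *)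
have tail : \sum_(z | K <= (ndiff z.1.1 z.2)%:R) q z <= 2 / n%:R.
  have -> : \sum_(z | K <= (ndiff z.1.1 z.2)%:R) q z = \sum_s \sum_t \sum_G
      (if K <= (ndiff s t)%:R then q (s, G, t) else 0).
    under [RHS]eq_bigr do rewrite exchange_big.
    rewrite big_mkcond pair_bigA pair_bigA/=.
    by apply: eq_bigr => -[[s G] t].
  have tail_s s : \sum_t \sum_G (if K <= (ndiff s t)%:R then q (s, G, t) else 0)
      <= n`!%:R^-1 * (2 / n%:R).
    apply: (@le_trans _ _ (n`!%:R^-1 *
        \sum_(t | K <= (ndiff s t)%:R) r ^+ ndiff s t)).
      rewrite mulr_sumr [leRHS]big_mkcond/=; apply: ler_sum => t _.
      case: ifP => _; last by rewrite big1.
      apply: (le_trans (ler_sum _ (fun G _ => qle s G t))).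
      by rewrite -mulr_suml -mulr_sumr sum_graph_prob -mulrA -exprMn.
    rewrite ler_wpM2l// (le_trans (sum_perm_ndiff_le _ _ s K r r0))//.
    apply: (@le_trans _ _ (\sum_(k < n.+1) n%:R ^- 2)).
      rewrite big_mkcond/=; apply: ler_sum => k _; case: ifP => Kk.
        apply: le_trans (tail_term_le _ _ _ _ _ n2 a1 am sm Kk).
        by rewrite ler_wpM2l// lerXn2r ?nnegrE// (le_trans r0).
      by rewrite invr_ge0 exprn_ge0.
    rewrite sumr_const card_ord -[leLHS]mulr_natl expr2 invfM mulrA.
    rewrite ler_pM2r ?invr_gt0// ler_pdivrMr// -natrM ler_nat mul2n -addnn.
    by rewrite -addn1 leq_add2l.
  apply: (le_trans (ler_sum _ (fun s _ => tail_s s))).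
  by rewrite sumr_const card_Sn -[leLHS]mulr_natl mulVKf.
(* Squared, this follows from 1/n <= 1/2 <= ln n. *)
have nm : n%:R^-1 <= m.
  apply: le_trans sm; rewrite -[leLHS]ger0_norm ?invr_ge0// -sqrtr_sqr ler_sqrt.
    rewrite expr2 ler_wpM2r ?invr_ge0//.
    apply: (le_trans _ (ln_nat_ge R n n2)).
    by rewrite lef_pV2 ?posrE// (ler_nat R 2).
  by rewrite divr_ge0// (le_trans _ (ln_nat_ge R n n2)).
move: tail nm; move: (\sum_(_ | _) _) (n%:R^-1) => u v; lra.
Qed.
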